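(* Let $(X,\tau)$ be a point-separable topological vector space over $\mathbb{R}$. Then $X$ has the fixed point property: for every nonempty, compact, convex subset $C\subseteq X$ and every $\tau$-continuous mapping $f:C\to C$, there exists $x_0\in C$ with $f(x_0)=x_0$.
   Context: All vector spaces are real; $\theta$ denotes the origin of $X$ and $X^*$ denotes the space of linear $\tau$-continuous functionals on $X$. The space $(X,\tau)$ is called point-separable if there is a subset $V\subseteq X^*$ such that, for $x\in X$, $v(x)=0$ for every $v\in V$ implies $x=\theta$. *)

(* Defs.v *)
From HB Require Import structures.
From mathcomp Require Import all_boot all_order all_algebra.
From mathcomp Require Import all_classical all_reals all_analysis.
Set Implicit Arguments. Unset Strict Implicit. Unset Printing Implicit Defensive.
Import Order.TTheory GRing.Theory Num.Theory.
Import numFieldTopology.Exports numFieldNormedType.Exports.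
Local Open Scope classical_set_scope.
Local Open Scope ring_scope.

Definition cont_lin_functional (R : realType) (X : topologicalLmodType R)
    (v : X -> R) : Prop :=
  (forall (a : R) (x y : X), v (a *: x + y) = a * v x + v y) /\ continuous v.

Definition point_separable (R : realType) (X : topologicalLmodType R) : Prop :=
  exists V : set (X -> R), V `<=` @cont_lin_functional R X /\
    (forall x : X, (forall v, V v -> v x = 0) -> x = 0).

(* Main.v *)
Require Import Defs.
From HB Require Import structures.
From mathcomp Require Import all_boot all_order all_algebra.
Set Implicit Arguments. Unset Strict Implicit. Unset Printing Implicit Defensive.

(** If [f] has no fixed point, compactness of [C] yields finitely many
    continuous functionals [v_k] such that every [x] in [C] satisfies
    [|v_k (f x) - v_k x| > 1] for some [k].  Choose a finite net [y_1, ..., y_n]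
    in [C] that is 1-dense for all the [v_k].  The closed sets
    [A_i = {l | |v_k (f (g l)) - v_k y_i| <= 1 for all k}], where
    [g l = l_1 y_1 + ... + l_n y_n], cover the standard simplex.  A closed cover
    of the simplex always admits a point [l] with [l \in A_i] whenever
    [l_i > 0]; averaging over [i] with weights [l_i] gives
    [|v_k (f x) - v_k x| <= 1] at [x = g l], a contradiction.

    The covering statement comes from Scarf's combinatorial lemma applied to the
    points of a fine grid in the simplex, ordered by each of the coordinates.  It
    needs no triangulation: the cells are the sets dominated by no grid point,
    and a parity count of such cells replaces Sperner's lemma. *)

(** * Scarf's lemma *)

Section Dominance.
Variables (U I : finType) (r : I -> U -> nat).
Hypothesis r_inj : forall i, injective (r i).

(** Scarf's condition: no point exceeds the minima of [S] in all orders at once. Rooms play the part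
    of the full cells of a triangulation. *)
Definition dominant (S : {set U}) :=
  [forall y, [exists i, [forall x in S, r i y <= r i x]]].

Definition room (S : {set U}) := dominant S && (#|S| == #|I|).

Lemma dominantP (S : {set U}) :
  reflect (forall y, exists i, forall x, x \in S -> r i y <= r i x) (dominant S).
Proof.
apply: (iffP forallP) => domS y.
  by have /existsP[i /forall_inP Hi] := domS y; exists i.
by have [i Hi] := domS y; apply/existsP; exists i; apply/forall_inP.
Qed.

Lemma dominantS (S S' : {set U}) : S' \subset S -> dominant S -> dominant S'.
Proof.
move=> /subsetP sS /dominantP domS; apply/dominantP => y.
by have [i Hi] := domS y; exists i => x /sS /Hi.
Qed.

(* A door is a dominant set with one element less than a room.  If [m i] is its
   minimum for the [i]-th order, then [m] takes exactly one value twice, say at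
   [a] and [b], and a room above the door arises by adding the top element of
   [above a] or of [above b]. *)
Section Door.
Variables (S : {set U}) (m : I -> U).
Hypothesis domS : dominant S.
Hypothesis cardS : #|S|.+1 = #|I|.
Hypothesis m_in : forall i, m i \in S.
Hypothesis m_min : forall i x, x \in S -> r i (m i) <= r i x.

(** For dominant [S], such a point lies below all of [S] in the order [a], so adding it to [S]
    changes only the minimum for [a]. *)
Definition above (a : I) := [set y | [forall i, (i != a) ==> (r i (m i) < r i y)]].

Definition top (a : I) (y : U) :=
  (y \in above a) && [forall z in above a, r a z <= r a y].

Lemma aboveP a y :
  reflect (forall i, i != a -> r i (m i) < r i y) (y \in above a).
Proof.
rewrite inE; apply: (iffP forallP) => H i.
  by move=> ia; have /implyP := H i; apply.
by apply/implyP; exact: H.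
Qed.

Lemma topP a y : reflect
  (y \in above a /\ forall z, z \in above a -> r a z <= r a y) (top a y).
Proof.
apply: (iffP andP) => -[ya H]; split=> //; first exact/forall_inP.
exact/forall_inP.
Qed.

Lemma exists_top a z : z \in above a -> exists y, top a y.
Proof.
move=> za; case: (@arg_maxnP _ z (mem (above a)) (r a) za) => y ya ymax.
by exists y; apply/topP; split=> // w /ymax.
Qed.

Lemma top_uniq a y y' : top a y -> top a y' -> y = y'.
Proof.
move=> /topP[ya yM] /topP[ya' yM']; apply: (@r_inj a).
by apply/eqP; rewrite eqn_leq yM// yM'.
Qed.

Lemma min_surj x : x \in S -> exists i, m i = x.
Proof.
move=> xS; have /dominantP/(_ x)[i Hi] := domS; exists i; apply: (@r_inj i).
by apply/eqP; rewrite eqn_leq m_min// Hi.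
Qed.

Lemma exists_collision : exists2 ab : I * I, ab.1 != ab.2 & m ab.1 = m ab.2.
Proof.
have imS : m @: [set: I] \subset S by apply/subsetP => _ /imsetP[i _ ->].
have : ~~ injectiveb m.
  apply/negP => /injectiveP m_inj.
  have := subset_leq_card imS.
  by rewrite card_imset// cardsT -cardS ltnn.
by move=> /injectivePn[a [b ab mab]]; exists (a, b).
Qed.

Variables (a b : I).
Hypothesis neq_ab : a != b.
Hypothesis mab : m a = m b.

(** A point of [S] equals some [m i], and [m a = m b] allows a choice of [i] other than [a]; it
    cannot exceed itself. *)
Lemma above_notin y : y \in above a -> y \notin S.
Proof.
move=> /aboveP ya; apply/negP => /min_surj[i].
have [-> iy|/ya + iy] := eqVneq i a; last by rewrite iy ltnn.
have : b != a by rewrite eq_sym.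
by move=> /ya; rewrite -mab iy ltnn.
Qed.

(** A common point would exceed the minimum of [S] in every order, against dominance. *)
Lemma above_disjoint y : y \in above a -> y \in above b -> False.
Proof.
move=> /aboveP ya /aboveP yb; have /dominantP/(_ y)[i Hi] := domS.
have [ia|/ya] := eqVneq i a; last by rewrite ltnNge Hi.
have /yb : i != b by rewrite ia.
by rewrite ltnNge Hi.
Qed.

(** In the enlarged set [y] is the minimum for [a], and the other minima are unchanged. A point of
    [above a] is bounded by [y] in the order [a]; any other point is at most [m i] for some [i]
    different from [a]. *)
Lemma top_room y : top a y -> room (y |: S).
Proof.
move=> /topP[ya yM]; rewrite /room cardsU1 above_notin// add1n cardS eqxx andbT.
apply/dominantP => z; have [za|] := boolP (z \in above a).
  have /dominantP/(_ z)[i Hi] := domS.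
  exists a => x; rewrite !inE => /predU1P[->|xS]; first exact: yM.
  have [<-|ia] := eqVneq i a; first exact: Hi.
  by move: za => /aboveP/(_ _ ia); rewrite ltnNge Hi.
rewrite inE negb_forall => /existsP[i]; rewrite negb_imply => /andP[ia].
rewrite -leqNgt => zi; exists i => x; rewrite !inE => /predU1P[->|xS].
  by rewrite (leq_trans zi)// ltnW//; move/aboveP: ya; apply.
by rewrite (leq_trans zi)// m_min.
Qed.

(** A room has as many points as there are orders, and each point [x] is minimal in some order
    [g x], so [g] maps the room bijectively onto the orders. Hence every order other than [g y]
    keeps its minimum in [S]. Since [m a = m b] and [a], [b] differ, [g y] is one of them. *)
Lemma room_top y : y \notin S -> room (y |: S) -> top a y \/ top b y.
Proof.
move=> yS /andP[/dominantP domR /eqP cardR].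
have [g Hg] : exists g : U -> I, forall x, x \in y |: S ->
    forall x', x' \in y |: S -> r (g x) x <= r (g x) x'.
  apply: (fin_all_exists (P := fun x i => x \in y |: S ->
    forall x', x' \in y |: S -> r i x <= r i x')) => x.
  by have [i Hi] := domR x; exists i.
have g_inj : {in y |: S &, injective g}.
  move=> x x' xR xR' gxx'; apply: (@r_inj (g x)); apply/eqP.
  by rewrite eqn_leq Hg//= gxx' Hg.
have g_surj i : exists2 x, x \in y |: S & g x = i.
  have : g @: (y |: S) = [set: I].
    by apply/eqP; rewrite eqEcard subsetT card_in_imset// cardR cardsT /=.
  by move=> /setP/(_ i); rewrite inE => /imsetP[x xR ->]; exists x.
have mg i : i != g y -> exists2 x, x \in S & g x = i /\ m i = x.
  have [x xR gx] := g_surj i; move=> igy.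
  have xS : x \in S.
    by move: xR; rewrite !inE => /predU1P[xy|//]; rewrite -gx xy eqxx in igy.
  exists x => //; split=> //; apply: (@r_inj i); apply/eqP.
  rewrite eqn_leq m_min//=.
  by rewrite -gx Hg// ?inE ?xS ?m_in ?orbT.
have ygy : top (g y) y.
  apply/topP; split.
    apply/aboveP => i igy; have [x xS [gx ->]] := mg _ igy.
    rewrite ltn_neqAle; apply/andP; split.
      by apply/eqP => /r_inj xy; rewrite -xy xS in yS.
    by rewrite -gx Hg// !inE ?xS ?eqxx ?orbT.
  move=> z /aboveP zy; have [i Hi] := domR z.
  have [<-|igy] := eqVneq i (g y); first by rewrite Hi// !inE eqxx.
  by have := zy _ igy; rewrite ltnNge Hi// !inE m_in orbT.
have [agy|agy] := eqVneq a (g y); first by left; rewrite agy.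
have [bgy|bgy] := eqVneq b (g y); first by right; rewrite bgy.
have [x xS [gx mx]] := mg _ agy; have [x' xS' [gx' mx']] := mg _ bgy.
by move: neq_ab; rewrite -gx -gx' -mx -mx' mab eqxx.
Qed.

End Door.

Definition rooms (S : {set U}) := [set R : {set U} | room R && (S \subset R)].

Section DoorRooms.
Variables (S : {set U}) (m : I -> U).
Hypothesis domS : dominant S.
Hypothesis cardS : #|S|.+1 = #|I|.
Hypothesis m_in : forall i, m i \in S.
Hypothesis m_min : forall i x, x \in S -> r i (m i) <= r i x.
Variables (a b : I).
Hypothesis neq_ab : a != b.
Hypothesis mab : m a = m b.

Lemma roomsP R : R \in rooms S <->
  exists2 y, R = y |: S & top m a y \/ top m b y.
Proof.
have neq_ba : b != a by rewrite eq_sym.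
have mba := esym mab.
rewrite inE; split=> [/andP[roomR sSR]|[y -> topy]].
  have /cards1P[y Dy] : #|R :\: S| == 1.
    move: roomR => /andP[_ /eqP cR].
    by rewrite cardsD (setIidPr sSR) cR -cardS subSnn.
  have Ry : R = y |: S by rewrite -(setID R S) Dy (setIidPr sSR) setUC.
  exists y => //; apply: (room_top m_in m_min neq_ab mab).
    have : y \in R :\: S by rewrite Dy set11.
    by rewrite inE => /andP[].
  by rewrite -Ry.
rewrite subsetUr andbT; case: topy => topy.
- exact: (top_room domS cardS m_in m_min neq_ab mab).
- exact: (top_room domS cardS m_in m_min neq_ba mba).
Qed.

Lemma card_rooms2 za zb :
  za \in above m a -> zb \in above m b -> #|rooms S| = 2.
Proof.
have neq_ba : b != a by rewrite eq_sym.
have mba := esym mab.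
move=> /exists_top[ya topa] /exists_top[yb topb].
have /topP[aa _] := topa; have /topP[bb _] := topb.
have -> : rooms S = [set ya |: S; yb |: S].
  apply/setP => R; apply/idP/idP.
    by move=> /roomsP[y -> [/(top_uniq topa)<-|/(top_uniq topb)<-]];
      rewrite !inE eqxx ?orbT.
  by move=> /set2P[]RE; apply/roomsP; [exists ya|exists yb] => //; [left|right].
(* If the two rooms coincided, [ya] would lie in [yb |: S] but not in [S], so it would equal [yb],
   against disjointness. *)
rewrite cards2; case: eqP => //= yab; exfalso.
apply: (above_disjoint domS m_in neq_ab aa).
suff -> : ya = yb by [].
have : ya \in yb |: S by rewrite -yab setU11.
rewrite !inE => /predU1P[//|yaS].
by have := above_notin domS m_in m_min neq_ab mab aa; rewrite yaS.
Qed.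

Lemma card_rooms1 za : za \in above m a -> above m b = set0 -> #|rooms S| = 1.
Proof.
move=> /exists_top[ya topa] b0.
suff -> : rooms S = [set ya |: S] by rewrite cards1.
apply/setP => R; rewrite inE; apply/idP/eqP => [/roomsP[y ->]|->].
  by case=> [/(top_uniq topa)<-//|/topP[]]; rewrite b0 inE.
by apply/roomsP; exists ya => //; left.
Qed.

End DoorRooms.

Lemma exists_min (S : {set U}) : S != set0 -> exists m : I -> U,
  (forall i, m i \in S) /\ (forall i x, x \in S -> r i (m i) <= r i x).
Proof.
move=> /set0Pn[x0 x0S].
exists (fun i => [arg min_(x < x0 in S) r i x]).
by split=> i; case: arg_minnP.
Qed.

End Dominance.

(* Scarf's fictitious points: [inr i] is lowest for the [i]-th order and above all
   of [T] for the others.  A subset [S] of [T + I] encodes the pair of a subset of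
   [T] and the set of indices [i] such that [inr i] is not in [S]. *)
Section Fictitious.
Variables (T I : finType) (r : I -> T + I -> nat) (c : T -> I) (t0 : T).
Hypothesis r_inj : forall i, injective (r i).
Hypothesis r_own : forall i u, r i (inr i) <= r i u.
Hypothesis r_other : forall i j x, i != j -> r i (inl x) < r i (inr j).
Hypothesis cardI : 1 < #|I|.

Definition colour (u : T + I) := match u with inl x => c x | inr i => i end.

Variable i0 : I.

Definition doors := [set S : {set T + I} |
  [&& dominant r S, #|S|.+1 == #|I| & colour @: S == [set~ i0]]].

(** The only door without a point of [T]; it plays the part of the boundary facet in Sperner's
    parity argument. *)
Definition outer_door : {set T + I} := [set inr i | i in [set~ i0]].

Lemma outer_door_in : outer_door \in doors.
Proof.
have cardO : #|outer_door|.+1 = #|I|.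
  rewrite card_imset; last by move=> i j [].
  by rewrite cardsC1 prednK// ltnW.
rewrite inE cardO eqxx /= -imset_comp (@eq_imset _ _ _ id)// imset_id eqxx andbT.
apply/dominantP => -[t|j].
  exists i0 => x /imsetP[i]; rewrite !inE => ii0 ->.
  by rewrite ltnW// r_other// eq_sym.
by exists j => x _; exact: r_own.
Qed.

Lemma door_neq0 S : S \in doors -> S != set0.
Proof.
rewrite inE => /and3P[_ /eqP cS _]; apply/eqP => S0.
by move: cardI; rewrite -cS S0 cards0.
Qed.

(** Such a door contains a point of [T], which bounds every minimum [m i]. Each [inr a'] then
    belongs to [above a'], so both collision indices have a top element. *)
Lemma card_rooms_inner S : S \in doors -> S != outer_door -> #|rooms r S| = 2.
Proof.
move=> Sdoor SO; have [m [m_in m_min]] := exists_min r (door_neq0 Sdoor).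
move: Sdoor; rewrite inE => /and3P[domS /eqP cS /eqP colS].
have [[a b] /= ab mab] := exists_collision cS m_in.
have [t tS] : exists t, inl t \in S.
  apply/existsP; apply: contraR SO; rewrite negb_exists => /forallP Sinr.
  rewrite eqEcard; apply/andP; split.
    apply/subsetP => -[t tS|i iS]; first by have := Sinr t; rewrite tS.
    rewrite imset_f// -colS; exact: (imset_f colour iS).
  have := outer_door_in; rewrite inE => /and3P[_ + _].
  by rewrite -cS eqSS => /eqP->.
have abv a' : inr a' \in above r m a'.
  by apply/aboveP => i ia; rewrite (leq_ltn_trans (m_min _ _ tS))// r_other.
exact: (card_rooms2 r_inj domS cS m_in m_min ab mab (abv a) (abv b)).
Qed.

(** Here [m i = inr i] for [i] other than [i0], while [m i0 = inr b] for some [b]. All of [T] lies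
    in [above i0]. But [above b] is empty: points of [T] fail in the order [i0], [inr b] fails there
    too, and any other [inr j] is lowest in the order [j]. *)
Lemma card_rooms_outer : #|rooms r outer_door| = 1.
Proof.
have [m [m_in m_min]] := exists_min r (door_neq0 outer_door_in).
have := outer_door_in; rewrite inE => /and3P[domS /eqP cS _].
have m_own i : i != i0 -> m i = inr i.
  move=> ii0; apply: (@r_inj i); apply/eqP; rewrite eqn_leq r_own andbT.
  by rewrite m_min// imset_f// !inE.
have [b bi0 mb] : exists2 b, b != i0 & m i0 = m b.
  by have /imsetP[b] := m_in i0; rewrite !inE => bi0 ->; exists b; rewrite ?m_own.
have i0b : i0 != b by rewrite eq_sym.
apply: (card_rooms1 r_inj domS cS m_in m_min i0b mb (za := inl t0)).
  apply/aboveP => i ii0; rewrite m_own// ltn_neqAle r_own andbT.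
  by apply/eqP => /r_inj.
apply/setP => y; rewrite [in RHS]inE; apply/negP => /aboveP yb.
case: y yb => [t|j] yb.
  by have := yb _ i0b; rewrite mb m_own// ltnNge ltnW// r_other.
have [jb|jb] := eqVneq j b.
  by have := yb _ i0b; rewrite mb m_own// jb ltnn.
by have := yb _ jb; rewrite ltnNge r_own.
Qed.

(** If such a room contains a door at all, its colours are exactly those other than [i0], and one
    colour is shared by two points [x] and [y]. Its doors are then precisely [R :\ x] and
    [R :\ y]. *)
Lemma room_doors_even R : room r R -> colour @: R != setT ->
  ~~ odd #|[set S in doors | S \subset R]|.
Proof.
move=> /andP[domR /eqP cR] colR.
have [->|] := eqVneq [set S in doors | S \subset R] set0; first by rewrite cards0.
move=> /set0Pn[S]; rewrite inE => /andP[Sdoor sSR].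
have := Sdoor; rewrite inE => /and3P[domS /eqP cS /eqP colS].
have /cards1P[y Dy] : #|R :\: S| == 1.
  by rewrite cardsD (setIidPr sSR) cR -cS subSnn.
have RE : R = y |: S by rewrite -(setID R S) Dy (setIidPr sSR) setUC.
have yS : y \notin S.
  by have := set11 y; rewrite -Dy inE => /andP[].
have cyi0 : colour y != i0.
  apply: contraNneq colR => cy.
  by rewrite RE imsetU1 cy colS; apply/eqP/setP => i; rewrite !inE orbN.
have /imsetP[x xS cxy] : colour y \in colour @: S by rewrite colS !inE.
have xy : x != y by apply: contraNneq yS => <-.
have yR : y \in R by rewrite RE setU11.
have xR : x \in R by rewrite RE setU1r.
have doorE z : z \in R -> colour @: (R :\ z) = [set~ i0] -> R :\ z \in doors.
  move=> zR colz; rewrite inE (dominantS _ domR) ?subD1set//= colz eqxx andbT.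
  by rewrite -cR (cardsD1 z R) zR.
have col_in z : z \in R -> colour z != i0.
  rewrite RE !inE => /predU1P[->//|zS].
  by have := imset_f colour zS; rewrite colS !inE.
have colx : colour @: (R :\ x) = [set~ i0].
  apply/setP => i; apply/imsetP/idP => [[z]|].
    by rewrite !inE => /andP[_ zR] ->; exact: col_in.
  rewrite -colS => /imsetP[z zS ->]; have [->|zx] := eqVneq z x.
    by exists y; rewrite // !inE eq_sym xy.
  by exists z; rewrite // !inE zx RE setU1r.
have coly : colour @: (R :\ y) = [set~ i0] by rewrite RE setU1K.
suff -> : [set S in doors | S \subset R] = [set R :\ x; R :\ y].
  rewrite cards2; case: eqP => //= /setP/(_ x); rewrite !inE eqxx xy xR.
  by [].
apply/setP => S'; rewrite in_set in_set2; apply/andP/orP => [[S'door sS'R]|].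
  move: S'door; rewrite inE => /and3P[_ /eqP cS' /eqP colS'].
  have /cards1P[z Dz] : #|R :\: S'| == 1.
    by rewrite cardsD (setIidPr sS'R) cR -cS' subSnn.
  have S'E : S' = R :\ z by rewrite -Dz setDDr setDv set0U (setIidPr sS'R).
  have [zx|zx] := eqVneq z x; first by left; rewrite S'E zx.
  have [zy|zy] := eqVneq z y; first by right; rewrite S'E zy.
  have : {in S' &, injective colour}.
    apply/imset_injP; rewrite colS' cardsC1 -cS'; exact/eqP.
  move=> /(_ x y); rewrite S'E !inE xR yR eq_sym zx eq_sym zy => /(_ isT isT).
  by move=> /(_ (esym cxy)) xyE; rewrite xyE eqxx in xy.
by case=> /eqP->; split; rewrite ?subD1set// doorE.
Qed.

(** Incidences between doors and rooms are counted twice. Summed over doors the count is odd,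
    because of the outer door; without a colourful room, the sum over rooms would be even. *)
Lemma exists_colourful_room : exists2 R, room r R & colour @: R = setT.
Proof.
have [/existsP[R /andP[roomR /eqP cR]]|] :=
  boolP [exists R, room r R && (colour @: R == setT)]; first by exists R.
rewrite negb_exists => /forallP noR; exfalso.
have dc : \sum_(S in doors) #|rooms r S| =
    \sum_(R | room r R) #|[set S in doors | S \subset R]|.
  under eq_bigr do rewrite -sum1_card; under [RHS]eq_bigr do rewrite -sum1_card.
  rewrite (exchange_big_dep (room r)) /=; last by move=> S R _; rewrite inE => /andP[].
  apply: eq_bigr => R roomR; apply: eq_bigl => S.
  by rewrite !inE roomR.
have even_rhs : 2 %| \sum_(R | room r R) #|[set S in doors | S \subset R]|.
  apply: dvdn_sum => R roomR; rewrite dvdn2 room_doors_even//.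
  by have := noR R; rewrite roomR.
move: even_rhs; rewrite -dc (bigD1 outer_door) ?outer_door_in//= card_rooms_outer.
rewrite dvdn_addl// dvdn_sum// => S /andP[Sd SO].
by rewrite card_rooms_inner.
Qed.

End Fictitious.

Section Scarf.
Variables (T I : finType) (r : I -> T -> nat) (c : T -> I) (t0 : T).

(** Ties of [r i] are broken by [enum_rank], which is smaller than the factor [#|T|]. *)
Let rank i x := r i x * #|T| + enum_rank x.

Let rank_inj i : injective (rank i).
Proof.
move=> x y; rewrite /rank => exy.
apply/enum_rank_inj/val_inj => /=.
move: (congr1 (modn^~ #|T|) exy).
by rewrite !modnMDl !modn_small.
Qed.

Let rank_le i x y : rank i x <= rank i y -> r i x <= r i y.
Proof.
rewrite /rank; apply: contraTT; rewrite -!ltnNge => yx.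
apply: leq_trans (leq_addr _ _); apply: (@leq_trans ((r i y).+1 * #|T|)).
  by rewrite mulSn addnC ltn_add2r.
by rewrite leq_mul2r yx orbT.
Qed.

Let bound i := (\max_x rank i x).+1.

(** The successors reserve the value 0 for [inr i] in its own order; the other fictitious points are
    placed beyond [bound i]. *)
Let ext i (u : T + I) := match u with
  | inl x => (rank i x).+1
  | inr j => if i == j then 0 else (bound i + enum_rank j).+1
  end.

Let rank_bound i x : rank i x < bound i.
Proof. by rewrite ltnS leq_bigmax. Qed.

Let ext_inj i : injective (ext i).
Proof.
have nb x (j : I) : rank i x != bound i + enum_rank j.
  by rewrite neq_ltn (leq_trans (rank_bound i x))// leq_addr.
move=> [x|j] [y|k] /=.
- by move=> [] /rank_inj ->.
- by case: eqP => // _ [] /eqP; rewrite (negbTE (nb _ _)).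
- by case: eqP => // _ [] /esym/eqP; rewrite (negbTE (nb _ _)).
- case: eqP => [<-|_]; case: eqP => [<-|_] //.
  by move=> [] /addnI/val_inj/enum_rank_inj ->.
Qed.

(** In a colourful room, a colour [i] whose [inr i] is absent must come from a point of [T]. An
    index witnessing dominance for a point of [T] is always in [C], since no such point is as low as
    [inr i] in the order [i]. *)
Lemma scarf : exists (s : {set T}) (C : {set I}),
  (forall y, exists2 i, i \in C & forall x, x \in s -> r i y <= r i x) /\
  (forall i, i \in C -> exists2 x, x \in s & c x = i).
Proof.
(* With a single index doors would be empty sets without minima; a maximum of the only order
   suffices. *)
have [I1|I1] := leqP #|I| 1.
  have eqI (i j : I) : i = j by apply/(fintype_le1P I1).
  have [t _ tmax] := @arg_maxnP _ t0 xpredT (r (c t0)) isT.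
  exists [set t], setT; split=> [y|i _]; last by exists t; rewrite ?set11.
  by exists (c t0) => // x /set1P ->; exact: tmax.
have ext_own i u : ext i (inr i) <= ext i u by rewrite /= eqxx.
have ext_other i j x : i != j -> ext i (inl x) < ext i (inr j).
  by move=> /= /negbTE ->; rewrite ltnS (leq_trans (rank_bound i x))// leq_addr.
have [R /andP[/dominantP domR _] colR] :=
  exists_colourful_room c t0 ext_inj ext_own ext_other I1 (c t0).
exists [set x | inl x \in R], [set i | inr i \notin R]; split=> [y|i].
  have [i Hi] := domR (inl y); exists i => [|x].
    by rewrite inE; apply/negP => /Hi; rewrite /= eqxx.
  by rewrite inE => /Hi; rewrite /= ltnS => /rank_le.
rewrite inE => iR; have /imsetP[[x|j] xR /= ix] : i \in colour c @: R.
- by rewrite colR inE.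
- by exists x; rewrite // inE.
- by rewrite ix xR in iR.
Qed.

End Scarf.

(** * Scarf's lemma on the integer grid of the simplex *)

Definition grid n N := {x : {ffun 'I_n -> 'I_N.+1} | \sum_i x i == N}.

Lemma grid_sum n N (x : grid n N) : \sum_i val x i = N.
Proof. exact/eqP/(valP x). Qed.

Lemma exists_grid n N (y : 'I_n -> nat) : \sum_i y i = N ->
  exists x : grid n N, forall i, val x i = y i :> nat.
Proof.
move=> sumy; have yN i : y i < N.+1 by rewrite ltnS -sumy (bigD1 i)//= leq_addr.
have xP : \sum_i [ffun i => Ordinal (yN i)] i == N.
  by rewrite -[X in _ == X]sumy; apply/eqP/eq_bigr => i _; rewrite ffunE.
by exists (exist (fun x : {ffun 'I_n -> 'I_N.+1} => \sum_i x i == N) _ xP) => i;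
  rewrite /= ffunE.
Qed.

(** Dominance forces the minima [m i] over [C] to sum to more than [N - n.+1]. Each point of [s] has
    total [N] and lies above these minima, so less than [n.+1] remains for its excess over [m i] in
    [C] and for its coordinates outside [C]. *)
Lemma grid_scarf n N (c : grid n.+1 N -> 'I_n.+1) :
  exists s : {set grid n.+1 N}, [/\ s != set0,
    forall x y i, x \in s -> y \in s -> val x i < val y i + n.+1 &
    forall i, (exists2 x, x \in s & c x = i) \/
      forall x, x \in s -> val x i < n.+1].
Proof.
have [t0 _] : exists x : grid n.+1 N, forall i,
    val x i = (if i == ord0 then N else 0) :> nat.
  by apply: exists_grid; rewrite -big_mkcond big_pred1_eq.
have [s [C [dom col]]] := scarf (fun i (x : grid n.+1 N) => val x i : nat) c t0.
exists s; have [j jC _] := dom t0.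
have [x0 x0s _] := col _ jC.
pose m (i : 'I_n.+1) := val [arg min_(x < x0 in s) (val x i : nat)] i : nat.
have m_le i x : x \in s -> m i <= val x i.
  by rewrite /m; case: arg_minnP => // y ys + xs; apply.
have m_ex i : exists2 x, x \in s & m i = val x i.
  by rewrite /m; case: arg_minnP => // y ys _; exists y.
(* otherwise some grid point would exceed every minimum [m i] by at least 1 *)
have large : N < \sum_(i in C) (m i).+1.
  rewrite ltnNge; apply/negP => small.
  (* The surplus [d] goes to the one coordinate [j] of [C], so that the total is exactly [N]. *)
  pose d := N - \sum_(i in C) (m i).+1.
  have [y yE] : exists y : grid n.+1 N, forall i, val y i =
      (if i \in C then (m i).+1 else 0) + (if i == j then d else 0) :> nat.
    apply: exists_grid; rewrite big_split /= -!big_mkcond big_pred1_eq /=.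
    by rewrite subnKC.
  have [i iC iy] := dom y; have [x xs mx] := m_ex i.
  by have := iy _ xs; rewrite yE iC -mx addSn ltnNge leq_addr.
have {}large : N < \sum_(i in C) m i + n.+1.
  apply: leq_trans large _; under eq_bigr do rewrite -addn1.
  by rewrite big_split /= leq_add2l sum1_card (leq_trans (max_card _))// card_ord.
have upC x i : x \in s -> i \in C -> val x i < m i + n.+1.
  move=> xs iC; have xN := grid_sum x; move: large.
  rewrite (bigD1 i)//= addnAC => large.
  rewrite -(ltn_add2r (\sum_(k in C | k != i) m k)).
  apply: leq_ltn_trans large; rewrite -[leqRHS]xN [leqRHS](bigID (mem C)) /=.
  rewrite [X in _ <= X + _](bigD1 i)//=.
  by rewrite -addnA leq_add2l (leq_trans _ (leq_addr _ _))// leq_sum// => k _;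
    exact: m_le.
have upNC x i : x \in s -> i \notin C -> val x i < n.+1.
  move=> xs iC; have xN := grid_sum x.
  rewrite -(ltn_add2l (\sum_(k in C) m k)).
  apply: leq_ltn_trans large; rewrite -[leqRHS]xN [leqRHS](bigID (mem C)) /=.
  rewrite leq_add ?leq_sum// => [k _|]; first exact: m_le.
  by rewrite (bigD1 i)//= leq_addr.
split.
- by apply/set0Pn; exists x0.
- move=> x y i xs ys; have [iC|iC] := boolP (i \in C).
    by apply: leq_trans (upC _ _ xs iC) _; rewrite leq_add2r m_le.
  by apply: leq_trans (upNC _ _ xs iC) _; rewrite leq_addl.
- move=> i; have [/col ?|iC] := boolP (i \in C); first by left.
  by right=> x xs; exact: upNC.
Qed.

(** * Closed covers of the simplex *)

From mathcomp Require Import all_classical all_reals all_analysis.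
From mathcomp Require Import ring.
Import Order.TTheory GRing.Theory Num.Theory.
Import numFieldTopology.Exports numFieldNormedType.Exports.
Local Open Scope classical_set_scope.
Local Open Scope ring_scope.

Definition simplex (R : realType) n : set 'rV[R]_n :=
  [set x | (forall i, 0 <= x ord0 i) /\ \sum_i x ord0 i = 1].

Lemma simplex_le1 (R : realType) n (x : 'rV[R]_n) i : simplex x -> x ord0 i <= 1.
Proof. by move=> [x0 <-]; rewrite (bigD1 i)//= lerDl sumr_ge0. Qed.

Lemma compact_simplex (R : realType) n : compact (@simplex R n).
Proof.
have cbox : compact [set x : 'rV[R]_n | forall i, x ord0 i \in `[0, 1]].
  by apply: (@rV_compact R n (fun=> `[0, 1]%classic)) => _; exact: segment_compact.
apply: (subclosed_compact _ cbox); last first.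
  by move=> x sx i; rewrite /= in_itv /= simplex_le1// andbT; case: sx.
have -> : @simplex R n = (\bigcap_(i in [set: 'I_n]) [set x | 0 <= x ord0 i]) `&`
    [set x | \sum_i x ord0 i = 1].
  apply/seteqP; split=> x [x0 x1]; split=> // i; first by move=> _; exact: x0.
  exact: (x0 i I).
apply: closedI.
  apply: closed_bigI => i _.
  apply: (@closed_comp _ _ (fun x : 'rV[R]_n => x ord0 i) [set y | 0 <= y]).
    by move=> x _; exact: coord_continuous.
  exact: closed_ge.
apply: (@closed_comp _ _ (fun x : 'rV[R]_n => \sum_i x ord0 i) [set y | y = 1]).
  move=> x _; apply: continuous_big => [|i _]; first exact: add_continuous.
  exact: coord_continuous.
exact: closed_eq.
Qed.

Lemma simplex_grid (R : realType) n N (x : grid n N.+1) :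
  simplex (\row_i ((val x i)%:R / N.+1%:R) : 'rV[R]_n).
Proof.
split=> [i|]; first by rewrite mxE divr_ge0.
under eq_bigr do rewrite mxE.
by rewrite -mulr_suml -natr_sum grid_sum divff// pnatr_eq0.
Qed.

Section ClosedCover.
Variables (R : realType) (n : nat) (A : 'I_n.+1 -> set 'rV[R]_n.+1).
Hypothesis coverA : forall x, simplex x -> exists i, A i x.

(** Grid points of denominator [N.+1] are coloured by a member of the cover containing them; the
    bounds of [grid_scarf] are then divided by [N.+1]. *)
Lemma approx_cover N : exists2 x, simplex x & forall i,
  (exists2 y, simplex y /\ ball x (n.+1%:R / N.+1%:R) y & A i y) \/
  x ord0 i < n.+1%:R / N.+1%:R.
Proof.
pose pt (x : grid n.+1 N.+1) : 'rV[R]_n.+1 := \row_i ((val x i)%:R / N.+1%:R).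
have /choice[c cA] : forall x, exists i, A i (pt x).
  by move=> x; exact/coverA/simplex_grid.
have [s [/set0Pn[x xs] near_s col]] := grid_scarf c.
have N0 : (0 : R) < N.+1%:R by rewrite ltr0n.
exists (pt x) => [|i]; first exact: simplex_grid.
have [[y ys cy]|sm] := col i.
  left; exists (pt y); last by rewrite -cy.
  split; first exact: simplex_grid.
  split=> [|i' j]; first by rewrite divr_gt0.
  rewrite /ball /= !mxE -mulrBl normrM normfV (gtr0_norm N0).
  rewrite ltr_pM2r ?invr_gt0// ltr_norml ltrBlDr ltrNl opprB ltrBlDr.
  by rewrite -!natrD !ltr_nat addnC near_s//= addnC near_s.
by right; rewrite mxE ltr_pM2r ?invr_gt0// ltr_nat sm.
Qed.

Hypothesis closedA : forall x i, simplex x -> ~ A i x ->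
  \forall y \near x, simplex y -> ~ A i y.

(** A cluster point of the approximate solutions works: if [x] has a positive [i]-th coordinate and
    is not in [A i], both alternatives of [approx_cover] fail near [x] for large [N]. *)
Lemma closed_cover_simplex :
  exists2 x, simplex x & forall i, 0 < x ord0 i -> A i x.
Proof.
have /choice[u uP] : forall N, exists x, simplex x /\ forall i,
    (exists2 y, simplex y /\ ball x (n.+1%:R / N.+1%:R) y & A i y) \/
    x ord0 i < n.+1%:R / N.+1%:R.
  by move=> N; have [x sx xP] := approx_cover N; exists x.
have [|x [sx clx]] := @compact_simplex R n.+1 (u @ \oo) _.
  by exists 0%N => // N _; have [] := uP N.
exists x => // i xi; apply: contrapT => nAx.
have [e /= e0 eA] := (nbhs_ballP _ _).1 (closedA sx nAx).
(* Two errors of size [d], one for the distance of [u N] to [x] and one for the mesh, must fit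
   within both [e] and the [i]-th coordinate. *)
pose d := Num.min e (x ord0 i) / 2.
have d0 : 0 < d by rewrite divr_gt0// lt_min e0.
have de : d + d <= e by rewrite -splitr ge_min lexx.
have dx : d + d <= x ord0 i by rewrite -splitr ge_min lexx orbT.
have small : \forall N \near \oo, n.+1%:R / N.+1%:R < d.
  have d1 : 0 < d / n.+1%:R by rewrite divr_gt0.
  near=> N; rewrite mulrC -ltr_pdivlMr//.
  by near: N; exact: (near_infty_natSinv_lt (PosNum d1)).
(* Recording the index together with the point makes the cluster property yield a term whose mesh is
   small as well. *)
have uN : (u @ \oo) [set y | exists2 N, y = u N & n.+1%:R / N.+1%:R < d].
  by apply: filterS small => N sN; exists N.
have [_ [[N -> sN] xuN]] := clx _ _ uN (nbhsx_ballx x d d0).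
have [sux /(_ i)[[y [sy uy] Ay]|ui]] := uP N.
  have /eA/(_ sy) : ball x e y; last by [].
  by apply: (le_ball de); apply: ball_triangle xuN _; apply: le_ball uy; exact: ltW.
have := xuN.2 ord0 i; rewrite /ball /= ltr_norml => /andP[_].
rewrite ltrBlDr => xd; have := lt_le_trans xd (le_trans _ dx).
suff /[swap]/[apply] : d + u N ord0 i <= d + d by rewrite ltxx.
by rewrite lerD2l ltW// (lt_trans ui).
Unshelve. all: by end_near. Qed.

End ClosedCover.

(** * Approximate fixed points *)

(** If no finite family sufficed, the sets containing [K] minus finitely many [P j] would form a
    proper filter; at a cluster point of it in [K] some [P j] holds locally, a contradiction. *)
Lemma compact_finite_family (T : topologicalType) (J : Type) (K : set T)
    (D : set J) (P : J -> set T) :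
  compact K ->
  (forall x, K x -> exists2 j, D j & \forall y \near x, K y -> P j y) ->
  exists n (s : 'I_n -> J), (forall i, D (s i)) /\
    forall x, K x -> exists i, P (s i) x.
Proof.
move=> cK coverK; apply: contrapT => nofin.
pose F := [set A : set T | exists n (s : 'I_n -> J), (forall i, D (s i)) /\
  forall x, K x -> (forall i, ~ P (s i) x) -> A x].
have F0 (A : set T) : K `<=` A -> F A.
  move=> KA; have s0 : 'I_0 -> J by case.
  by exists 0%N, s0; split=> [[]//|x /KA].
have FF : ProperFilter F.
  split.
    move=> [n [s [Ds Ps]]]; apply: nofin; exists n, s; split=> // x Kx.
    by apply: contrapT => nP; apply: (Ps x Kx) => i Pi; apply: nP; exists i.
  split.
  - exact: F0.
  - move=> A B [n [s [Ds sA]]] [m [t [Dt tB]]]; exists (n + m)%N.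
    exists (fun i => match fintype.split i with inl a => s a | inr b => t b end).
    split=> [i|x Kx nP]; first by case: fintype.split.
    split; [apply: sA|apply: tB] => // i.
    + by have := nP (unsplit (inl i)); rewrite unsplitK.
    + by have := nP (unsplit (inr i)); rewrite unsplitK.
  - by move=> A B AB [n [s [Ds sA]]]; exists n, s; split=> // x Kx /(sA x Kx)/AB.
have [|x [Kx clx]] := cK F FF.
  exact: F0.
have [j Dj Pj] := coverK x Kx.
have FP : F (K `&` ~` P j).
  by exists 1%N, (fun=> j); split=> // y Ky nP; split=> //; exact: (nP ord0).
by have [y [[Ky nPy] /(_ Ky)]] := clx _ _ FP Pj.
Qed.

Lemma convex_combination (R : realType) (X : lmodType R) (C : set X) n
    (y : 'I_n -> X) (l : 'I_n -> R) :
  convex_set C -> (forall i, C (y i)) -> (forall i, 0 <= l i) ->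
  \sum_i l i = 1 -> C (\sum_i l i *: y i).
Proof.
move=> cC Cy l0 l1.
(* The induction needs weights of arbitrary positive total, since removing the last point destroys
   normalisation. *)
suff : 0 < \sum_i l i -> C ((\sum_i l i)^-1 *: \sum_i l i *: y i).
  by rewrite l1 invr1 scale1r; apply.
elim: n => [|n IHn] in y l Cy l0 {l1} *; first by rewrite big_ord0 ltxx.
rewrite !big_ord_recr /=; set s := \sum_(i < n) _; set z := \sum_(i < n) _.
set a := l ord_max => sa0.
have a0 : 0 <= a by exact: l0.
have s0 : 0 <= s by apply: sumr_ge0.
have [sE|s_neq0] := eqVneq s 0.
  have zE : z = 0.
    apply: big1 => i _; have /eqP := sE; rewrite psumr_eq0//.
    by move=> /allP/(_ i); rewrite mem_index_enum => /(_ isT)/eqP ->; rewrite scale0r.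
  rewrite sE add0r in sa0.
  by rewrite sE zE !add0r scalerA mulVf ?gt_eqF// scale1r.
have s_gt0 : 0 < s by rewrite lt_neqAle eq_sym s_neq0.
have Cz : C (s^-1 *: z) by exact: IHn.
have p01 : 0 <= s / (s + a) <= 1.
  by rewrite ler_pdivrMr// mul1r lerDl a0 andbT divr_ge0// ltW.
have := cC (s^-1 *: z) (y ord_max) (Itv01 (andP p01).1 (andP p01).2).
rewrite !inE => /(_ Cz (Cy _)); congr C.
rewrite /conv /= /unstable.onem scalerA scalerDr scalerA; congr (_ *: _ + _ *: _).
  by field; rewrite s_neq0 gt_eqF.
by field; rewrite gt_eqF.
Qed.

Section ContLin.
Variables (R : realType) (X : topologicalLmodType R) (v : X -> R).
Hypothesis cl : cont_lin_functional v.

Lemma cont_lin0 : v 0 = 0.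
Proof.
by have := cl.1 (-1) 0 0; rewrite scaler0 addr0 mulN1r addNr.
Qed.

Lemma cont_linB x y : v (x - y) = v x - v y.
Proof.
by have := cl.1 (-1) y x; rewrite scaleN1r mulN1r addrC => ->; rewrite addrC.
Qed.

Lemma cont_lin_sum n (l : 'I_n -> R) (y : 'I_n -> X) :
  v (\sum_i l i *: y i) = \sum_i l i * v (y i).
Proof.
elim: n => [|n IHn] in l y *; first by rewrite !big_ord0 cont_lin0.
by rewrite !big_ord_recl cl.1 IHn.
Qed.

Lemma cont_lin_scale a : cont_lin_functional (fun x => a * v x).
Proof.
split=> [b x y|x]; first by rewrite cl.1 mulrDr mulrCA.
by apply: cvgM; [exact: cvg_cst|exact: cl.2].
Qed.

End ContLin.

Section ApproximateFixedPoint.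
Variables (R : realType) (X : topologicalLmodType R) (C : set X) (f : X -> X).
Hypothesis C0 : C !=set0.
Hypothesis compactC : compact C.
Hypothesis convexC : convex_set C.
Hypothesis f_cont : {within C, continuous f}.
Hypothesis fC : forall x, C x -> C (f x).

Lemma cvg_functional_within (v : X -> R) x :
  cont_lin_functional v -> C x ->
  v (f y) @[y --> within C (nbhs x)] --> v (f x).
Proof.
move=> [_ v_cont] Cx.
apply: (@cvg_comp _ _ _ f v _ (nbhs (f x))); last exact: v_cont.
exact: (subspace_continuousP _ _).1.
Qed.

Lemma approximate_fixed_point m (v : 'I_m -> X -> R) :
  (forall k, cont_lin_functional (v k)) ->
  exists2 x, C x & forall k, `|v k (f x) - v k x| <= 1.
Proof.
move=> cl.
have [n [y [Cy net]]] : exists n (y : 'I_n -> X), (forall i, C (y i)) /\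
    forall z, C z -> exists i, forall k, `|v k z - v k (y i)| <= 1.
  apply: (compact_finite_family
    (P := fun (y : X) z => forall k, `|v k z - v k y| <= 1)) => // z Cz.
  exists z => //.
  suff : \forall w \near z, forall k, `|v k w - v k z| <= 1 by apply: filterS.
  apply: filter_forall => k.
  have /cvgrPdist_le/(_ _ ltr01) near_z := (cl k).2 z.
  by apply: filterS near_z => w; rewrite distrC.
case: n => [|n] in y Cy net *.
  by have [z Cz] := C0; have [[]] := net z Cz.
pose g (l : 'rV[R]_n.+1) := \sum_i l ord0 i *: y i.
have g_cont : continuous g.
  apply: continuous_big => [|i _ l]; first exact: add_continuous.
  apply: (@cvg_comp _ _ _ (fun l : 'rV[R]_n.+1 => (l ord0 i : R^o, y i))
    (fun z : R^o * X => z.1 *: z.2) _ (nbhs (l ord0 i : R^o, y i))).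
    by apply: (@cvg_pair _ _ _ (nbhs l) (nbhs (l ord0 i : R^o)) (nbhs (y i)));
      [exact: coord_continuous|exact: cvg_cst].
  exact: (@scale_continuous R X (l ord0 i : R^o, y i)).
have gC l : simplex l -> C (g l).
  by move=> [l0 l1]; apply: convex_combination.
pose A i := [set l | forall k, `|v k (f (g l)) - v k (y i)| <= 1].
have [l sl lA] : exists2 l, simplex l & forall i, 0 < l ord0 i -> A i l.
  apply: closed_cover_simplex => [l sl|l i sl nA].
    exact/net/fC/gC.
  have [k nk] : exists k, 1 < `|v k (f (g l)) - v k (y i)|.
    apply: contrapT => h; apply: nA => k; rewrite leNgt; apply/negP => h1.
    by apply: h; exists k.
  pose O := [set t | 1 < `|t - v k (y i)|].
  have oO : open O.
    apply: (@open_comp _ _ (fun t => `|t - v k (y i)|) [set t | 1 < t]).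
      move=> t _; apply: cvg_norm; apply: cvgB; [exact: cvg_id|exact: cvg_cst].
    exact: open_gt.
  (* Continuity of [f] is only within [C], and [g l'] is known to lie in [C] only for [l'] in the
     simplex; so [A i] is shown closed relative to the simplex. *)
  have near_l := g_cont l _ (cvg_functional_within (cl k) (gC _ sl)
    (open_nbhs_nbhs (conj oO nk))).
  apply: (@filterS _ (nbhs l) (nbhs_filter l) _ _ _ near_l) => l' gl' sl' /(_ k).
  by rewrite leNgt (gl' (gC _ sl')).
exists (g l) => [|k]; first exact: gC.
have [l0 l1] := sl.
have -> : v k (f (g l)) - v k (g l) =
    \sum_i l ord0 i * (v k (f (g l)) - v k (y i)).
  under eq_bigr do rewrite mulrBr.
  by rewrite sumrB -mulr_suml l1 mul1r /g cont_lin_sum.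
rewrite -l1; apply: le_trans (ler_norm_sum _ _ _) _; apply: ler_sum => i _.
rewrite normrM ger0_norm//.
(* Zero weights contribute nothing, so membership in [A i] is called upon only for positive ones. *)
have := l0 i; rewrite le_eqVlt => /predU1P[<-|li]; first by rewrite mul0r.
by rewrite -[leRHS]mulr1 ler_wpM2l//; exact: lA.
Qed.

End ApproximateFixedPoint.

Theorem theorem4p3 (R : realType) (X : topologicalLmodType R) :
  point_separable X ->
  forall (C : set X) (f : X -> X),
    C !=set0 -> compact C -> convex_set C ->
    {within C, continuous f} -> (forall x, C x -> C (f x)) ->
    exists2 x0, C x0 & f x0 = x0.
Proof.
move=> [V [Vcl Vsep]] C f C0 compactC convexC f_cont fC.
apply: contrapT => nofix.
(* The family ranges over all continuous linear functionals because the rescaled ones below may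
   leave [V]. *)
have [|m [v [cl sep]]] := compact_finite_family (D := @cont_lin_functional R X)
  (P := fun v x => 1 < `|v (f x) - v x|) compactC _.
  move=> x Cx.
  have [v Vv vx] : exists2 v, V v & v (f x - x) != 0.
    apply: contrapT => h; apply: nofix; exists x => //; apply/eqP.
    rewrite -subr_eq0; apply/eqP/Vsep => v Vv; apply: contrapT => vx.
    by apply: h; exists v => //; exact/eqP.
  have cl := Vcl _ Vv.
  (* The scaling gives displacement exactly 2 at [x], so it stays above 1 at nearby points of
     [C]. *)
  pose w z := 2 / v (f x - x) * v z.
  have clw : cont_lin_functional w by exact: cont_lin_scale.
  exists w => //.
  have wx : w (f x) - w x = 2.
    by rewrite /w -mulrBr -cont_linB// divfK.
  have cw : w (f y) - w y @[y --> within C (nbhs x)] --> (2 : R).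
    rewrite -wx; apply: cvgB.
      exact: cvg_functional_within.
    by apply: cvg_within_filter; exact: clw.2.
  have : \forall t \near (2 : R), 1 < t.
    by apply: open_nbhs_nbhs; split; [exact: open_gt|rewrite /= ltr1n].
  move=> /cw near_x; apply: (@filterS _ (nbhs x) _ _ _ _ near_x) => y h Cy.
  by apply: lt_le_trans (h Cy) _; exact: ler_norm.
have [x Cx xP] := approximate_fixed_point C0 compactC convexC f_cont fC cl.
by have [i] := sep x Cx; rewrite ltNge xP.
Qed.
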